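(* Let $f=q/p:\mathbb{H}^d\to\mathbb{C}$ be analytic and rational, where $p,q\in\mathbb{C}[z_1,\dots,z_d]$, $p$ has no zeros in $\mathbb{H}^d$, and $f$ has a non-tangential limit at $0$. Let $P_M$ be the lowest order nonzero homogeneous term of $p$ at $0$, and for $z$ with $P_M(z)\ne0$ let $$f(\lambda z)=\sum_{j\ge0}F_j(z)\lambda^j$$ be the power series expansion of the one-variable function $\lambda\mapsto f(\lambda z)$ at $\lambda=0$. Let $k\ge0$ be an integer. Then $f$ is non-tangentially $C^k$ at $0$ via $\mathbb{H}^d$ if and only if the sum $$F(z):=\sum_{j=0}^kF_j(z)$$ belongs to $\mathbb{C}[z_1,\dots,z_d]$, in which case, non-tangentially, $$f(z)=F(z)+O(r^{k+1}),\qquad r=|z_1|.$$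
   Context: $\mathbb{H}$ is the open upper half plane. For $c\ge1$ let $AR_c=\{z\in\mathbb{H}^d:1/c\le a/b\le c\text{ for all }a,b\in\{|z_1|,\dots,|z_d|,\operatorname{Im}z_1,\dots,\operatorname{Im}z_d\}\}$. A statement (limit, $o(\cdot)$ or $O(\cdot)$) holds non-tangentially at $0$ if it holds as $z\to0$ with $z\in AR_c$, for every $c\ge 1$ (constants may depend on $c$); $f$ has a non-tangential limit at $0$ if there is a single $\omega\in\mathbb{C}$ with $f(z)\to\omega$ non-tangentially. $f$ is non-tangentially $C^k$ at $0$ if there is a polynomial $G\in\mathbb{C}[z_1,\dots,z_d]$ of degree at most $k$ with $f(z)=G(z)+o(r^k)$ non-tangentially, $r=|z_1|$. When $f$ has a non-tangential limit $b$ at $0$ and $p$ vanishes to order $M$ at $0$, it is known that $q$ vanishes to order at least $M$ and its degree-$M$ homogeneous term is $bP_M$; hence $\lambda\mapsto f(\lambda z)$ (after cancelling $\lambda^M$) is analytic near $\lambda=0$ whenever $P_M(z)\ne0$, and $P_M$ has no zeros on $\mathbb{H}^d$. The $F_j$ are rational functions. *)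

(* Defs.v *)
From mathcomp Require Import all_boot all_order all_algebra.
From mathcomp Require Import mpoly complex.
From mathcomp Require Import boolp classical_sets reals topology.
From mathcomp Require Import normedtype sequences landau.

Set Implicit Arguments.
Unset Strict Implicit.
Unset Printing Implicit Defensive.

Import Order.TTheory GRing.Theory Num.Theory numFieldNormedType.Exports.

Local Open Scope classical_set_scope.
Local Open Scope ring_scope.

(* The field of complex numbers enters below as an abstract numClosedFieldType
   [C], on which MathComp-Analysis puts the topology and the normed module
   structure induced by the modulus; it is to be instantiated with [R[i]] for
   [R : realType].  The order of [C] compares only elements with the same
   imaginary part, so that [0 < x] and [1 <= c] force [x] and [c] to be real.
   The number of variables is [d.+1], and z_1 is [z 0 0]. *)

Definition uhp (C : numClosedFieldType) (d : nat) : set 'rV[C]_d.+1 :=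
  [set z | forall i, 0 < 'Im (z 0 i)].

Definition nt_moduli (C : numClosedFieldType) (d : nat) (z : 'rV[C]_d.+1) : set C :=
  [set a | exists i, a = `|z 0 i| \/ a = 'Im (z 0 i)].

Definition AR (C : numClosedFieldType) (d : nat) (c : C) : set 'rV[C]_d.+1 :=
  [set z | uhp z /\
    forall a b, nt_moduli z a -> nt_moduli z b -> c^-1 <= a / b /\ a / b <= c].

Definition nt_nbhs (C : numClosedFieldType) (d : nat) (c : C) :
  set_system 'rV[C]_d.+1 := within (AR c) (nbhs (0 : 'rV[C]_d.+1)).

Global Instance nt_nbhs_filter (C : numClosedFieldType) (d : nat) (c : C) :
  Filter (@nt_nbhs C d c).
Proof. exact: within_filter. Qed.

Canonical nt_nbhs_filter_on (C : numClosedFieldType) (d : nat) (c : C) :=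
  FilterType (@nt_nbhs C d c) (@nt_nbhs_filter C d c).

Definition has_nt_limit (C : numClosedFieldType) (d : nat)
    (f : 'rV[C]_d.+1 -> C) : Prop :=
  exists w : C, forall c : C, 1 <= c -> f z @[z --> nt_nbhs c] --> w.

Definition nt_littleo (C : numClosedFieldType) (d : nat) (k : nat)
    (f : 'rV[C]_d.+1 -> C) : Prop :=
  forall c : C, 1 <= c ->
    f =o_ (nt_nbhs c) (fun z : 'rV[C]_d.+1 => `|z 0 0| ^+ k : C).

Definition nt_bigO (C : numClosedFieldType) (d : nat) (k : nat)
    (f : 'rV[C]_d.+1 -> C) : Prop :=
  forall c : C, 1 <= c ->
    f =O_ (nt_nbhs c) (fun z : 'rV[C]_d.+1 => `|z 0 0| ^+ k : C).

Definition peval (C : numClosedFieldType) (d : nat) (p : {mpoly C[d.+1]})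
    (z : 'rV[C]_d.+1) : C := p.@[fun i => z 0 i].

(* [msize G <= k.+1] says that [G] has total degree at most [k]. *)
Definition nt_Ck (C : numClosedFieldType) (d : nat) (k : nat)
    (f : 'rV[C]_d.+1 -> C) : Prop :=
  exists G : {mpoly C[d.+1]},
    (msize G <= k.+1)%N /\ nt_littleo k (fun z => f z - peval G z).

(* Takes the value 0 at the zeros of [p]. *)
Definition ratfun (C : numClosedFieldType) (d : nat) (q p : {mpoly C[d.+1]})
    (z : 'rV[C]_d.+1) : C := peval q z / peval p z.

Definition homog_part (C : numClosedFieldType) (d : nat) (M : nat)
    (p : {mpoly C[d.+1]}) : {mpoly C[d.+1]} := pihomog mdeg M p.

Definition vanishing_order (C : numClosedFieldType) (d : nat)
    (p : {mpoly C[d.+1]}) (M : nat) : Prop :=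
  homog_part M p != 0 /\ forall m, (m < M)%N -> homog_part m p = 0.

(* [a] is the coefficient sequence of the power series of [l |-> f (l *: z)] at
   0.  The neighbourhood is punctured because a quotient is not evaluated
   sensibly at [l = 0] before a power of [l] is cancelled. *)
Definition radial_expansion (C : numClosedFieldType) (d : nat)
    (f : 'rV[C]_d.+1 -> C) (z : 'rV[C]_d.+1) (a : nat -> C) : Prop :=
  \forall l \near (0 : C)^', series (fun j => a j * l ^+ j) @ \oo --> f (l *: z).

(* A function given on the nonempty Zariski open set where [P] does not vanish
   is the restriction of a polynomial. *)
Definition polynomial_off (C : numClosedFieldType) (d : nat)
    (P : {mpoly C[d.+1]}) (F : 'rV[C]_d.+1 -> C) : Prop :=
  exists G : {mpoly C[d.+1]}, forall z, peval P z != 0 -> F z = peval G z.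

(* Main.v *)
(* Comparing coefficients of l in p(l z) f(l z) = q(l z) gives
   Q_m = sum_i P_i F_(m-i) wherever P_M does not vanish.  On AR_c one has
   |p(z)| >= K r^M near 0: join z to a multiple of r of a fixed point e of H^d
   with P_M(e) <> 0 and use that a one-variable polynomial of degree n without
   zeros in |t| < rho satisfies |g(t)| <= |g(0)| (1 + |t|/rho)^n.  Rescaling gives
   |P_M(z)| >= K r^M, hence F_j = O(r^j) by induction on j, hence
   q - p F = O(r^(M+k+1)) and f - F = O(r^(k+1)), whether or not F is a polynomial.
   Conversely, if f = G + o(r^k), then q - p G = o(r^(M+k)) along every ray in H^d, so
   its homogeneous parts of degree at most M + k vanish, first on H^d and then
   identically, and dividing by P_M gives F_j = G_j for j <= k. *)
Require Import Defs.
From mathcomp Require Import all_boot all_order all_algebra.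
From mathcomp Require Import mpoly complex.
From mathcomp Require Import boolp classical_sets reals topology.
From mathcomp Require Import normedtype sequences landau.
From mathcomp Require Import ring.
Import Order.TTheory GRing.Theory Num.Theory numFieldNormedType.Exports.
Local Open Scope classical_set_scope.
Local Open Scope ring_scope.

Set Implicit Arguments.
Unset Strict Implicit.

(** * One-variable polynomials near 0 *)

Lemma small_pos (C : numFieldType) (dl B e : C) :
  0 < dl -> 0 <= B -> 0 < e -> exists s, [/\ 0 < s, s < dl, s <= 1 & B * s < e].
Proof.
(* The reciprocal of a sum dominating 1, 1/dl and B/e meets all the bounds at once, without a
   minimum in a partially ordered field. *)
move=> dl0 B0 e0; set t := 1 + dl^-1 + B / e.
have Be0 : 0 <= B / e by rewrite divr_ge0 // ltW.
have t1 : 1 <= t by rewrite /t -addrA lerDl addr_ge0 // invr_ge0 ltW.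
have t0 : 0 < t by exact: lt_le_trans t1.
have ltt : dl^-1 < t.
  by rewrite /t addrAC ltr_pwDl // ?ltr_wpDr // lerDr.
exists t^-1; split; rewrite ?invr_gt0 //.
- by rewrite -[dl]invrK ltf_pV2 // posrE invr_gt0.
- by rewrite invf_le1.
- rewrite ltr_pdivrMr // mulrC -ltr_pdivrMr // /t.
  by rewrite ltr_pwDl // addr_gt0 ?invr_gt0.
Qed.

Lemma pos_lt2 (C : numFieldType) (a b : C) :
  0 < a -> 0 < b -> exists s, [/\ 0 < s, s < a & s < b].
Proof.
move=> a0 b0; have b0' : 0 <= b^-1 by rewrite invr_ge0 ltW.
have [s [s0 sa _]] := small_pos a0 b0' ltr01; exists s; split=> //.
by move: p; rewrite mulrC ltr_pdivrMr // mul1r.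
Qed.

Lemma poly_expansion (C : numFieldType) (g : {poly C}) (m : nat) :
  (forall i, (i < m)%N -> g`_i = 0) ->
  exists2 B, 0 <= B &
    forall s, `|s| <= 1 -> `|g.[s] - g`_m * s ^+ m| <= B * `|s| ^+ m.+1.
Proof.
move=> g0; exists (\sum_(i < size g) `|g`_(m.+1 + i)|) => [|s s1].
  exact: sumr_ge0.
rewrite (@horner_coef_wide _ (m.+1 + size g)) ?leq_addl // big_split_ord /=.
rewrite big_ord_recr big1 /= => [|i _]; last by rewrite g0 ?mul0r.
rewrite add0r addrAC subrr add0r mulr_suml.
apply: (le_trans (ler_norm_sum _ _ _)); apply: ler_sum => i _.
by rewrite normrM normrX ler_wpM2l // ler_wiXn2l // leq_addr.
Qed.

Lemma poly_upper_bound (C : numFieldType) (g : {poly C}) (m : nat) :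
  (forall i, (i < m)%N -> g`_i = 0) ->
  exists2 D, 0 <= D & forall s, `|s| <= 1 -> `|g.[s]| <= D * `|s| ^+ m.
Proof.
move=> /poly_expansion [B B0 HB]; exists (`|g`_m| + B) => [|s s1].
  by rewrite addr_ge0.
have -> : g.[s] = g`_m * s ^+ m + (g.[s] - g`_m * s ^+ m) by rewrite addrC subrK.
apply: (le_trans (ler_normD _ _)); rewrite mulrDl normrM normrX lerD2l.
apply: (le_trans (HB s s1)); rewrite exprS mulrA ler_wpM2r ?exprn_ge0 //.
by rewrite -[leRHS]mulr1 ler_wpM2l.
Qed.

Lemma poly_lower_bound (C : numFieldType) (g : {poly C}) (m : nat) :
  (forall i, (i < m)%N -> g`_i = 0) -> g`_m != 0 ->
  exists dl, [/\ 0 < dl, dl <= 1 & forall s, `|s| < dl ->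
    `|g`_m| / 2 * `|s| ^+ m <= `|g.[s]|].
Proof.
move=> /poly_expansion [B B0 HB] gm.
have gm2 : 0 < `|g`_m| / 2 by rewrite divr_gt0 ?normr_gt0.
have [dl [dl0 _ dl1 Bdl]] := small_pos ltr01 B0 gm2.
exists dl; split=> // s sdl; have s1 := le_trans (ltW sdl) dl1.
have : `|g`_m * s ^+ m| <= `|g.[s]| + B * `|s| ^+ m.+1.
  rewrite -lerBlDl; apply: le_trans (HB s s1); rewrite distrC.
  exact: lerB_dist.
rewrite normrM normrX -lerBlDr; apply: le_trans.
rewrite {2}[`|g`__|]splitr mulrDl -addrA lerDl subr_ge0 exprS mulrA.
rewrite ler_wpM2r ?exprn_ge0 //; apply: le_trans (ltW Bdl).
by rewrite ler_wpM2l // ltW.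
Qed.

(** At a first nonzero coefficient g_i with i <= N, for small positive s the o-bound is at most, and
    the remainder strictly below, half of |g_i| s^i: a contradiction. *)
Lemma poly_littleo_coef (C : numFieldType) (g : {poly C}) (N : nat) :
  (forall e, 0 < e ->
     exists2 dl, 0 < dl & forall s, 0 < s -> s < dl -> `|g.[s]| <= e * s ^+ N) ->
  forall i, (i <= N)%N -> g`_i = 0.
Proof.
move=> go; elim/ltn_ind => i IH iN; apply/eqP/negPn/negP => gi.
have gi2 : 0 < `|g`_i| / 2 by rewrite divr_gt0 ?normr_gt0.
have [B B0 HB] := poly_expansion (fun j ji => IH j ji (leq_trans (ltnW ji) iN)).
have [dl dl0 Hdl] := go _ gi2.
have [s [s0 sdl s1 Bs]] := small_pos dl0 B0 gi2.
have ns : `|s| = s by rewrite gtr0_norm.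
have := HB s; rewrite ns => /(_ s1) H1.
have H2 : `|g.[s]| <= `|g`_i| / 2 * s ^+ i.
  apply: (le_trans (Hdl s s0 sdl)); rewrite ler_pM2l // ler_wiXn2l //.
  exact: ltW.
have : `|g`_i * s ^+ i| <= `|g`_i| / 2 * s ^+ i + B * s ^+ i.+1.
  have -> : g`_i * s ^+ i = g.[s] - (g.[s] - g`_i * s ^+ i).
    by rewrite opprB addrC subrK.
  by apply: (le_trans (ler_normB _ _)); apply: lerD.
rewrite normrM normrX ns exprS mulrA -mulrDl ler_pM2r ?exprn_gt0 //.
rewrite [X in X <= _]splitr lerD2l => /(lt_le_trans Bs).
by rewrite ltxx.
Qed.

Lemma poly_eq0_shift_nat (C : numFieldType) (g : {poly C}) (a : C) :
  (forall n : nat, g.[a + n%:R] = 0) -> g = 0.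
Proof.
move=> g0; apply: (@roots_geq_poly_eq0 _ _ [seq a + i%:R | i <- iota 0 (size g)]).
- by apply/allP => _ /mapP [i _ ->]; apply/rootP.
- rewrite map_inj_uniq ?iota_uniq // => i j /addrI /eqP.
  by rewrite eqr_nat => /eqP.
- by rewrite size_map size_iota.
Qed.

(** Every root r has |r| >= dl, so each linear factor satisfies |t - r| <= |r| (1 + |t|/dl);
    multiply over the roots, at most n in number. *)
Lemma poly_growth_rootfree (C : numClosedFieldType) (g : {poly C}) (n : nat)
    (dl : C) : 0 < dl -> (size g <= n.+1)%N ->
  (forall t, `|t| < dl -> g.[t] != 0) ->
  forall t, `|g.[t]| <= `|g.[0]| * (1 + `|t| / dl) ^+ n.
Proof.
move=> dl0 sg rootfree t; have [rs gE] := closed_field_poly_normal g.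
have g_neq0 : g != 0.
  by apply: contraTneq (rootfree 0 _); rewrite ?normr0 // => ->; rewrite horner0 eqxx.
have b1 : 1 <= 1 + `|t| / dl by rewrite lerDl divr_ge0 // ltW.
have b0 : 0 <= 1 + `|t| / dl by exact: le_trans b1.
have srs : (size rs <= n)%N.
  by move: sg; rewrite gE size_scale ?lead_coef_eq0 // size_prod_XsubC.
apply: (@le_trans _ _ (`|g.[0]| * (1 + `|t| / dl) ^+ size rs)); last first.
  by rewrite ler_wpM2l // ler_weXn2l.
have rsP : all (fun r => dl <= `|r|) rs.
  apply/allP => r rrs; rewrite real_leNgt ?(gtr0_real dl0) ?normr_real //.
  apply/negP => /rootfree; have /rootP -> : root g r; last by rewrite eqxx.
  by rewrite gE rootZ ?lead_coef_eq0 // root_prod_XsubC.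
have gh x : g.[x] = lead_coef g * \prod_(r <- rs) (x - r).
  by rewrite {1}gE hornerZ horner_prod; congr (_ * _); apply: eq_bigr => y _;
    rewrite hornerXsubC.
rewrite !gh !normrM -mulrA ler_wpM2l // !normr_prod.
elim: rs rsP {gE gh srs} => [|r rs IH] /=; first by rewrite !big_nil mul1r.
case/andP => dlr /IH IHrs; rewrite !big_cons exprS mulrACA.
apply: ler_pM => //; first exact: prodr_ge0.
apply: (le_trans (ler_normB _ _)).
rewrite sub0r normrN mulrDr mulr1 addrC lerD2l mulrCA.
by rewrite -[leLHS]mulr1 ler_wpM2l // ler_pdivlMr // mul1r.
Qed.

(** * Restriction to lines and homogeneous parts *)

Definition line_poly (C : numClosedFieldType) (d : nat) (g : {mpoly C[d.+1]})
    (z w : 'rV[C]_d.+1) : {poly C} :=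
  mmap polyC (fun i => (z 0 i)%:P + (w 0 i) *: 'X) g.

Lemma horner_line_poly (C : numClosedFieldType) (d : nat)
    (g : {mpoly C[d.+1]}) (z w : 'rV[C]_d.+1) (t : C) :
  (line_poly g z w).[t] = peval g (z + t *: w).
Proof.
rewrite /line_poly /peval mevalE /mmap horner_sum; apply: eq_bigr => m _.
rewrite hornerM hornerC /mmap1 horner_prod; congr (_ * _).
by apply: eq_bigr => i _; rewrite horner_exp !mxE !hornerE mulrC.
Qed.

Lemma size_line_poly (C : numClosedFieldType) (d : nat)
    (g : {mpoly C[d.+1]}) (z w : 'rV[C]_d.+1) :
  (size (line_poly g z w) <= msize g)%N.
Proof.
apply: (leq_trans (size_sum _ _ _)); apply/bigmax_leqP_seq => m mg _.
apply: leq_trans (msize_mdeg_lt mg).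
rewrite mul_polyC; apply: (leq_trans (size_scale_leq _ _)).
rewrite /mmap1 mdegE; elim/big_rec2: _ => [|i h n _ IH]; first by rewrite size_poly1.
apply: (leq_trans (size_polyMleq _ _)).
set l := _ + _; have sl : (size (l ^+ m i) <= (m i).+1)%N.
  apply: (leq_trans (size_poly_exp_leq _ _)); rewrite ltnS.
  rewrite -[leqRHS]mul1n leq_mul2r; apply/orP; right.
  rewrite -subn1 leq_subLR; apply: (leq_trans (size_polyD _ _)).
  rewrite geq_max (leq_trans (size_polyC_leq1 _)) //=.
  by rewrite (leq_trans (size_scale_leq _ _)) // size_polyX.
by rewrite -subn1 leq_subLR add1n -addSn -addnS leq_add.
Qed.

(** On the ray through z a monomial of degree e becomes a multiple of t^e, so the grading by degree
    turns into the coefficient sequence of a one-variable polynomial. *)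
Lemma coef_line_poly0 (C : numClosedFieldType) (d : nat)
    (g : {mpoly C[d.+1]}) (z : 'rV[C]_d.+1) (m : nat) :
  (line_poly g 0 z)`_m = peval (homog_part m g) z.
Proof.
rewrite /line_poly /homog_part /peval pihomogE raddf_sum /= coef_sum.
rewrite [RHS]big_mkcond /=; apply: eq_bigr => u _.
have -> : mmap1 (fun i => ((0 : 'rV[C]_d.+1) 0 i)%:P + z 0 i *: 'X) u
          = (\prod_i z 0 i ^+ u i) *: 'X^(mdeg u).
  rewrite /mmap1 mdegE -prodrXr; elim/big_rec3: _ => [|i a b e _ ->]; rewrite ?scale1r //.
  by rewrite mxE add0r exprZn -scalerAl -scalerAr scalerA.
rewrite coefCM coefZ coefXn mevalZ mevalX eq_sym.
by case: eqP => _; rewrite ?mulr1 ?mulr0.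
Qed.

Lemma line_poly_coef_lt (C : numClosedFieldType) (d : nat)
    (g : {mpoly C[d.+1]}) (M : nat) (z : 'rV[C]_d.+1) :
  vanishing_order g M -> forall m, (m < M)%N -> (line_poly g 0 z)`_m = 0.
Proof. by case=> _ g0 m mM; rewrite coef_line_poly0 g0 //; exact: meval0. Qed.

(** * Polynomials vanishing on the half space *)

Lemma expansion_base_inj (n B : nat) (a b : 'I_n -> nat) :
  (forall i, a i < B)%N -> (forall i, b i < B)%N ->
  (\sum_(i < n) a i * B ^ i = \sum_(i < n) b i * B ^ i)%N -> a =1 b.
Proof.
elim: n a b => [|n IH] a b ltaB ltbB; first by move=> _ [].
(* This splits off the lowest base-B digit, which is the remainder mod B; the quotient carries the
   other digits for the induction. *)
have step (u : 'I_n.+1 -> nat) : (forall i, u i < B)%N ->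
    (\sum_(i < n.+1) u i * B ^ i
     = (\sum_(i < n) u (lift ord0 i) * B ^ i) * B + u ord0)%N.
  move=> ltuB; rewrite big_ord_recl /= muln1 addnC big_distrl /=.
  by congr (_ + _)%N; apply: eq_bigr => i _; rewrite /bump expnSr mulnA.
have B0 : (0 < B)%N by exact: leq_ltn_trans (ltaB ord0).
rewrite !step // => /[dup] /(congr1 (modn^~ B)) /= + /(congr1 (divn^~ B)) /=.
rewrite !modnMDl !divnMDl // !modn_small // !divn_small // !addn0.
move=> ab0 /(IH _ _ (fun i => ltaB _) (fun i => ltbB _)) abS i.
by case: (unliftP ord0 i) => [j|] ->.
Qed.

(* Kronecker substitution z_i = t^(B^i), with B larger than every exponent, maps
   distinct monomials to distinct powers of t. *)
Lemma mpoly_neq0_exists (C : numFieldType) (n : nat) (g : {mpoly C[n]}) :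
  g != 0 -> exists v : 'I_n -> C, g.@[v] != 0.
Proof.
move=> g_neq0; pose B := (msize g).+1.
pose wt (m : 'X_{1.. n}) := (\sum_(i < n) m i * B ^ i)%N.
pose h : {poly C} := \sum_(m <- msupp g) g@_m *: 'X^(wt m).
have lt_B m : m \in msupp g -> forall i, (m i < B)%N.
  move=> /msize_mdeg_lt mg i; rewrite ltnS; apply: leq_trans (ltnW mg).
  by rewrite mdegE (bigD1 i) //= leq_addr.
have [m mg] : exists m, m \in msupp g.
  case E: (msupp g) => [|m s]; last by exists m; rewrite inE eqxx.
  by move: g_neq0; rewrite -msupp_eq0 E eqxx.
have h_neq0 : h != 0.
  apply: contraTneq mg => h0; rewrite mcoeff_msupp negbK.
  have := congr1 (fun k : {poly C} => k`_(wt m)) h0.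
  rewrite coef0 coef_sum => hm.
  case: (boolP (m \in msupp g)) => [mg|]; last by rewrite mcoeff_msupp negbK.
  rewrite -{}hm (bigD1_seq m) ?msupp_uniq //= coefZ coefXn eqxx mulr1.
  rewrite big_seq_cond big1 ?addr0 // => u /andP [ug um].
  rewrite coefZ coefXn; case: eqP => [wtE|]; last by rewrite mulr0.
  case/eqP: um; apply/mnmP.
  by apply: (expansion_base_inj (lt_B _ ug) (lt_B _ mg)) (esym wtE).
apply: contrapT => nex; case/eqP: h_neq0; apply: (@poly_eq0_shift_nat _ _ 0) => k.
set t := 0 + k%:R; suff -> : h.[t] = g.@[fun i => t ^+ (B ^ i)].
  by apply/eqP/negPn/negP => gt; apply: nex; exists (fun i => t ^+ (B ^ i)).
rewrite mevalE horner_sum; apply: eq_bigr => u _; rewrite hornerZ hornerXn.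
congr (_ * _); rewrite -prodrXr; apply: eq_bigr => i _.
by rewrite -exprM mulnC.
Qed.

Lemma norm_Im_le (C : numClosedFieldType) (x : C) : `|'Im x| <= `|x|.
Proof.
by rewrite -normrN -ReMil -[leRHS]mul1r -(normCi C) -normrM leif_normC_Re_Creal.
Qed.

(** Going up along (i, ..., i) by more than the sum of the |z_i| makes all imaginary parts positive;
    the steps n supply infinitely many such points on one line. *)
Lemma uhp_translate (C : numClosedFieldType) (d : nat) (z : 'rV[C]_d.+1) :
  exists a : C, forall n : nat, uhp (z + (a + n%:R) *: const_mx 'i).
Proof.
exists (1 + \sum_i `|z 0 i|) => n i.
have s0 : 0 <= \sum_j `|z 0 j| by exact: sumr_ge0.
have ar : 1 + \sum_j `|z 0 j| + n%:R \is Num.real.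
  by rewrite ger0_real // addr_ge0 ?ler0n // addr_ge0.
rewrite !mxE raddfD /= ImMl // Im_i mulr1.
have : - `|z 0 i| <= 'Im (z 0 i).
  have := norm_Im_le (z 0 i); rewrite real_ler_norml ?Creal_Im //.
  by case/andP.
rewrite -subr_ge0 opprK (bigD1 i) //= => h.
set S := \sum_(j | _) _; have S0 : 0 <= S by exact: sumr_ge0.
have -> : 'Im (z 0 i) + (1 + (`|z 0 i| + S) + n%:R)
          = 1 + ('Im (z 0 i) + `|z 0 i| + (S + n%:R)) by ring.
by rewrite ltr_pwDl // addr_ge0 // addr_ge0 ?ler0n.
Qed.

(** The restriction of g to the line through z in direction (i, ..., i) has infinitely many zeros in
    H^d, hence is 0, also at its base point z. *)
Lemma peval_eq0_uhp (C : numClosedFieldType) (d : nat) (g : {mpoly C[d.+1]}) :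
  (forall z, uhp z -> peval g z = 0) -> forall z, peval g z = 0.
Proof.
move=> g0 z; have [a ha] := uhp_translate z.
have l0 : line_poly g z (const_mx 'i) = 0.
  by apply: (poly_eq0_shift_nat (a := a)) => n; rewrite horner_line_poly g0.
by rewrite -[z]addr0 -(scale0r (const_mx 'i)) -horner_line_poly l0 horner0.
Qed.

Lemma uhp_peval_neq0 (C : numClosedFieldType) (d : nat) (g : {mpoly C[d.+1]}) :
  g != 0 -> exists2 z, uhp z & peval g z != 0.
Proof.
move=> /mpoly_neq0_exists [v gv]; apply: contrapT => nex.
suff /peval_eq0_uhp g0 : forall z, uhp z -> peval g z = 0.
  case/eqP: gv; rewrite -(g0 (\row_i v i)); apply: meval_eq => i.
  by rewrite mxE.
by move=> z uz; apply/eqP/negPn/negP => gz; apply: nex; exists z.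
Qed.

Lemma Im_add_gt0 (C : numClosedFieldType) (x y : C) :
  `|y| < 'Im x -> 0 < 'Im (x + y).
Proof.
move=> /(le_lt_trans (norm_Im_le y)); rewrite real_ltr_norml ?Creal_Im //.
by case/andP => h _; rewrite raddfD /= -ltrBlDl sub0r.
Qed.

Lemma uhp_nt_moduli_gt0 (C : numClosedFieldType) (d : nat) (z : 'rV[C]_d.+1) a :
  uhp z -> nt_moduli z a -> 0 < a.
Proof.
move=> uz [i [] ->]; last exact: uz.
by apply: lt_le_trans (norm_Im_le _); rewrite normr_gt0 gt_eqF.
Qed.

(** * Geometry of the approach regions *)

Section ApproachRegion.
Variables (C : numClosedFieldType) (d : nat).
Implicit Types (z : 'rV[C]_d.+1) (c : C).

Lemma AR_norm0_gt0 c z : AR c z -> 0 < `|z 0 0|.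
Proof. by case=> uz _; apply: (uhp_nt_moduli_gt0 uz); exists 0; left. Qed.

Lemma AR_norm_le c z i : AR c z -> `|z 0 i| <= c * `|z 0 0|.
Proof.
move=> Az; have r0 := AR_norm0_gt0 Az; case: Az => _ /(_ `|z 0 i| `|z 0 0|).
case; [by exists i; left|by exists 0; left|].
by rewrite ler_pdivrMr.
Qed.

Lemma AR_norm_le_Im c z i : AR c z -> `|z 0 0| <= c * 'Im (z 0 i).
Proof.
case=> uz /(_ `|z 0 0| ('Im (z 0 i))).
case; [by exists 0; left|by exists i; right|].
by rewrite ler_pdivrMr.
Qed.

Lemma AR_scale c s z : 0 < s -> AR c z -> AR c (s *: z).
Proof.
move=> s0 [uz Az].
have mods a : nt_moduli (s *: z) a -> exists2 a', nt_moduli z a' & a = s * a'.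
  case=> i; rewrite mxE normrM (gtr0_norm s0) ImMl ?gtr0_real //.
  by case=> ->; [exists `|z 0 i| | exists ('Im (z 0 i))] => //; exists i; [left|right].
split=> [i|a b /mods [a' ma ->] /mods [b' mb ->]].
  by rewrite mxE ImMl ?gtr0_real // mulr_gt0.
by rewrite -mulf_div divff ?gt_eqF // mul1r; exact: Az.
Qed.

Lemma uhp_AR z : uhp z -> exists2 c, 1 <= c & AR c z.
Proof.
(* [S] bounds every modulus and [T] every inverse modulus, so [S * T] bounds all ratios; adding 1
   secures c >= 1. *)
move=> uz; pose S := \sum_i (`|z 0 i| + 'Im (z 0 i)).
pose T := \sum_i (`|z 0 i|^-1 + ('Im (z 0 i))^-1).
have n0 i : 0 <= `|z 0 i| by [].
have I0 i : 0 <= 'Im (z 0 i) by rewrite ltW.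
have SP a : nt_moduli z a -> a <= S /\ a^-1 <= T.
  case=> i aE.
  have iS : `|z 0 i| + 'Im (z 0 i) <= S.
    by rewrite /S (bigD1 i) //= lerDl sumr_ge0 // => j _; rewrite addr_ge0.
  have iT : `|z 0 i|^-1 + ('Im (z 0 i))^-1 <= T.
    rewrite /T (bigD1 i) //= lerDl sumr_ge0 // => j _.
    by rewrite addr_ge0 ?invr_ge0.
  by case: aE => ->; split; [apply: le_trans iS|apply: le_trans iT
    |apply: le_trans iS|apply: le_trans iT]; rewrite ?lerDl ?lerDr ?invr_ge0.
have c1 : 1 <= 1 + S * T.
  by rewrite lerDl mulr_ge0 // sumr_ge0 // => i _; rewrite addr_ge0 ?invr_ge0.
have le a b : nt_moduli z a -> nt_moduli z b -> a / b <= 1 + S * T.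
  move=> ma mb; have [aS _] := SP _ ma; have [_ bT] := SP _ mb.
  have a0 := uhp_nt_moduli_gt0 uz ma; have b0 := uhp_nt_moduli_gt0 uz mb.
  apply: (@le_trans _ _ (S * T)); last by rewrite lerDr.
  by apply: ler_pM => //; rewrite ?invr_ge0 ltW.
exists (1 + S * T) => //; split=> // a b ma mb; split; last exact: le.
have a0 := uhp_nt_moduli_gt0 uz ma; have b0 := uhp_nt_moduli_gt0 uz mb.
rewrite -[a / b]invrK lef_pV2 ?invf_div ?le //.
  by rewrite posrE (lt_le_trans ltr01).
by rewrite posrE divr_gt0.
Qed.

(** In AR_c every |z_i| is at most c |z_1|, so the size of z_1 alone measures the distance to 0. *)
Lemma near_ntP c (P : 'rV[C]_d.+1 -> Prop) : 1 <= c ->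
  (\forall z \near nt_nbhs c, P z) <->
  exists2 dl, 0 < dl & forall z, AR c z -> `|z 0 0| < dl -> P z.
Proof.
move=> c1; have c0 : 0 < c by exact: lt_le_trans c1.
rewrite /nt_nbhs near_withinE; split.
  move=> /nbhs_ballP [e /= e0 He]; exists (e / c) => [|z Az ze].
    by rewrite divr_gt0.
  apply: He => //; split=> // i j; rewrite ord1 mxE -ball_normE /ball_ /= sub0r normrN.
  apply: le_lt_trans (AR_norm_le _ Az) _.
  by rewrite mulrC -ltr_pdivlMr.
case=> dl dl0 Hdl; apply/nbhs_ballP; exists dl => //= z ze Az; apply: Hdl => //.
have := ze.2 0 0; rewrite mxE -ball_normE /ball_ /= sub0r normrN.
exact.
Qed.

End ApproachRegion.

(** * Lower bounds for p and its lowest homogeneous term *)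

Section LowerBound.
Variables (C : numClosedFieldType) (d : nat) (p : {mpoly C[d.+1]}) (M : nat).
Hypothesis p_neq0 : forall z, uhp z -> peval p z != 0.
Hypothesis p_order : vanishing_order p M.

(* For e in the half space with P_M(e) <> 0, the segment from z to |z_1| e lies in
   the half space together with a disc of parameters of radius independent of z,
   so p(|z_1| e) is bounded by a constant multiple of p(z). *)
Lemma denominator_lower_bound c : 1 <= c ->
  exists K dl, [/\ 0 < K, 0 < dl & forall z, AR c z -> `|z 0 0| < dl ->
    K * `|z 0 0| ^+ M <= `|peval p z|].
Proof.
move=> c1; have c0 : 0 < c by exact: lt_le_trans c1.
have [e ue Pe] := uhp_peval_neq0 p_order.1.
have [|dl [dl0 dl1 Hdl]] := poly_lower_bound (line_poly_coef_lt e p_order).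
  by rewrite coef_line_poly0.
pose E := \sum_i `|e 0 i|.
have E0 : 0 <= E by exact: sumr_ge0.
have Ec : 0 < E + c by exact: ltr_wpDl.
have eE i : `|e 0 i| <= E by rewrite /E (bigD1 i) //= lerDl sumr_ge0.
(* For |t| < [rho] the displacement t (r e - z) has coordinates of modulus below [rho] r (E + c) = r
   / c, which is at most Im z_i. *)
pose rho := (c * (E + c))^-1.
have rho0 : 0 < rho by rewrite invr_gt0 mulr_gt0.
pose A := (1 + 1 / rho) ^+ msize p.
have A0 : 0 < A by rewrite exprn_gt0 // addr_gt0 // divr_gt0.
exists (`|peval (homog_part M p) e| / 2 / A), dl; split=> //.
  by rewrite !divr_gt0 ?normr_gt0.
move=> z Az rdl; set r := `|z 0 0| in rdl *.
have r0 : 0 < r := AR_norm0_gt0 Az.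
pose g := line_poly p z (r *: e - z).
have sg : (size g <= (msize p).+1)%N by rewrite leqW // size_line_poly.
have rootfree t : `|t| < rho -> g.[t] != 0.
  move=> trho; rewrite horner_line_poly; apply: p_neq0 => i; rewrite !mxE.
  apply: Im_add_gt0; rewrite normrM.
  apply: (@lt_le_trans _ _ (r / c)); last first.
    by rewrite ler_pdivrMr // mulrC; exact: AR_norm_le_Im.
  apply: (@le_lt_trans _ _ (`|t| * (r * (E + c)))).
    rewrite ler_wpM2l // (le_trans (ler_normB _ _)) // normrM (gtr0_norm r0).
    rewrite mulrDr lerD ?(ler_wpM2l (ltW r0)) //.
    by rewrite mulrC; exact: AR_norm_le.
  have -> : r / c = rho * (r * (E + c)) by rewrite /rho; field; rewrite !gt_eqF.
  by rewrite ltr_pM2r // mulr_gt0.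
(* At t = 0 and t = 1 the line passes through z and r e, so the growth bound compares p(r e) with
   p(z). *)
have := poly_growth_rootfree rho0 sg rootfree 1.
rewrite normr1 !horner_line_poly scale0r addr0 scale1r addrC subrK -/A => gA.
rewrite mulrAC ler_pdivrMr //; apply: le_trans gA.
have -> : peval p (r *: e) = (line_poly p 0 e).[r].
  by rewrite horner_line_poly add0r.
by have := Hdl r; rewrite coef_line_poly0 (gtr0_norm r0); exact.
Qed.

(** As s -> 0 along the ray through z, p(s z) / s^M tends to P_M(z), so the bound for p near 0
    passes to P_M, with the same K and at every z in AR_c. *)
Lemma homog_part_lower_bound c : 1 <= c ->
  exists2 K, 0 < K & forall z, AR c z ->
    K * `|z 0 0| ^+ M <= `|peval (homog_part M p) z|.
Proof.
move=> /denominator_lower_bound [K [dl [K0 dl0 HK]]]; exists K => // z Az.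
have r0 := AR_norm0_gt0 Az; set r := `|z 0 0| in r0 *.
rewrite real_leNgt ?normr_real //; last first.
  by rewrite ger0_real // mulr_ge0 ?exprn_ge0 // ltW.
apply/negP; rewrite -subr_gt0 => gap.
have [B B0 HB] := poly_expansion (line_poly_coef_lt z p_order).
have [s [s0 sdl s1 Bs]] := small_pos (divr_gt0 dl0 r0) B0 gap.
have := HK (s *: z) (AR_scale s0 Az); rewrite mxE normrM (gtr0_norm s0) -/r.
rewrite -ltr_pdivlMr // => /(_ sdl).
rewrite -[s *: z]add0r -horner_line_poly exprMn => HKs.
have := HB s; rewrite coef_line_poly0 (gtr0_norm s0) => /(_ s1) HBs.
have : `|(line_poly p 0 z).[s]|
       <= (`|peval (homog_part M p) z| + B * s) * s ^+ M.
  rewrite mulrDl -mulrA -exprS -(gtr0_norm s0) -normrX -normrM.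
  rewrite (gtr0_norm s0) -lerBlDl; apply: le_trans HBs.
  exact: lerB_dist.
move=> /(le_trans HKs); rewrite mulrCA mulrC ler_pM2r ?exprn_gt0 // -lerBlDl.
by move=> /le_lt_trans /(_ Bs); rewrite ltxx.
Qed.

End LowerBound.

(** * Power series remainders and comparison of coefficients *)

Lemma geometric_sum_le (C : numFieldType) (rho : C) (N n : nat) :
  0 <= rho -> rho * 2 <= 1 -> \sum_(N <= j < N + n) rho ^+ j <= 2 * rho ^+ N.
Proof.
move=> rho0 rho2.
(* The subtracted term closes the induction: rho <= 1/2 gives 2 rho^(m+1) <= rho^m. *)
suff h : \sum_(N <= j < N + n) rho ^+ j <= 2 * rho ^+ N - 2 * rho ^+ (N + n).
  by apply: (le_trans h); rewrite gerBl mulr_ge0 ?exprn_ge0.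
elim: n => [|n IH]; first by rewrite addn0 big_geq // subrr.
rewrite addnS big_nat_recr ?leq_addr //=; apply: (le_trans (lerD IH (lexx _))).
rewrite -addrA lerD2l exprS -subr_ge0.
have X0 : 0 <= rho ^+ (N + n) by exact: exprn_ge0.
set X : C := rho ^+ (N + n) in X0 *.
have -> : - (2 * (rho * X)) - (- (2 * X) + X) = (1 - rho * 2) * X by ring.
by rewrite mulr_ge0 // subr_ge0.
Qed.

(** Convergence at one x > 0 bounds |a_j| x^j; for |l| < x/2 the tail from N on is then dominated by
    a geometric series of ratio at most 1/2. *)
Lemma power_series_remainder (C : numFieldType) (a : nat -> C) (f : C -> C) :
  (\forall l \near (0 : C)^', series (fun j => a j * l ^+ j) @ \oo --> f l) ->
  forall N : nat, exists B dl, [/\ 0 <= B, 0 < dl &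
    forall l, l != 0 -> `|l| < dl ->
      `|f l - \sum_(0 <= j < N) a j * l ^+ j| <= B * `|l| ^+ N].
Proof.
move=> /nbhs_ballP [e /= e0 cvg_f] N.
have {}cvg_f l : l != 0 -> `|l| < e -> series (fun j => a j * l ^+ j) @ \oo --> f l.
  move=> l0 le; apply: cvg_f => //=.
  by rewrite -ball_normE /ball_ /= sub0r normrN.
pose x := e / 2; have x0 : 0 < x by rewrite divr_gt0.
have nx : `|x| = x by rewrite gtr0_norm.
have xe : x < e by rewrite ltr_pdivrMr // mulr_natr mulr2n ltrDl.
(* From some n0 on, partial sums lie within 1 of f(x), so consecutive ones differ by at most 2; a
   finite sum covers the earlier terms. *)
have [A A0 HA] : exists2 A : C, 0 <= A & forall j, `|a j| * x ^+ j <= A.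
  have := cvg_f x; rewrite gt_eqF // nx => /(_ isT xe) /cvgrPdist_le /(_ 1 ltr01).
  move=> [n0 _ Hn0]; exists (2 + \sum_(j < n0) `|a j| * x ^+ j) => [|j].
    by rewrite addr_ge0 // sumr_ge0 // => i _; rewrite mulr_ge0 ?exprn_ge0 // ltW.
  have [jn|nj] := ltnP j n0.
    rewrite (bigD1 (Ordinal jn)) //= addrCA lerDl addr_ge0 // sumr_ge0 // => i _.
    by rewrite mulr_ge0 ?exprn_ge0 // ltW.
  apply: (@le_trans _ _ 2); last first.
    by rewrite lerDl sumr_ge0 // => i _; rewrite mulr_ge0 ?exprn_ge0 // ltW.
  have -> : `|a j| * x ^+ j = `|a j * x ^+ j| by rewrite normrM normrX nx.
  have -> : a j * x ^+ j = (f x - series (fun j => a j * x ^+ j) j)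
                           - (f x - series (fun j => a j * x ^+ j) j.+1).
    by rewrite /series /= big_nat_recr //=; ring.
  apply: (le_trans (ler_normB _ _)).
  by rewrite -[2]/(1 + 1) lerD //; apply: Hn0 => //=; rewrite leqW.
exists (A * 2 * (x ^- N)), (x / 2); split.
- by rewrite !mulr_ge0 // invr_ge0 exprn_ge0 // ltW.
- by rewrite divr_gt0.
move=> l l0 lx; pose rho : C := `|l| / x.
have rho0 : 0 <= rho by rewrite divr_ge0 // ltW.
have rho2 : rho * 2 <= 1.
  by rewrite -ler_pdivlMr // /rho ler_pdivrMr // mul1r mulrC ltW.
have le_e : `|l| < e.
  apply: lt_trans lx _; apply: lt_trans xe.
  by rewrite ltr_pdivrMr // mulr_natr mulr2n ltrDl.
have -> : A * 2 * x ^- N * `|l| ^+ N = A * (2 * rho ^+ N).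
  by rewrite /rho [in RHS]expr_div_n -!mulrA (mulrC (x ^- N)).
(* f(l) is only a limit, so it is replaced, up to eps, by a partial sum of N + n0 terms. *)
apply/ler_addgt0Pr => eps eps0.
have /cvgrPdist_le /(_ eps eps0) [n0 _ Hn0] := cvg_f l l0 le_e.
have := Hn0 (N + n0)%N (leq_addl _ _); set S := series _ _ => fS.
have -> : f l - \sum_(0 <= j < N) a j * l ^+ j
          = (S - \sum_(0 <= j < N) a j * l ^+ j) + (f l - S) by ring.
apply: (le_trans (ler_normD _ _)); rewrite lerD //.
rewrite /S /series /= (big_cat_nat _ (n := N)) ?leq_addr //= addrAC subrr add0r.
apply: (le_trans (ler_norm_sum _ _ _)).
apply: (@le_trans _ _ (\sum_(N <= j < N + n0) A * rho ^+ j)).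
  apply: ler_sum => j _; rewrite normrM normrX.
  have -> : `|a j| * `|l| ^+ j = `|a j| * x ^+ j * rho ^+ j.
    by rewrite -mulrA -exprMn (mulrC x) /rho divfK // gt_eqF.
  by rewrite ler_wpM2r ?exprn_ge0.
by rewrite -mulr_sumr ler_wpM2l // geometric_sum_le.
Qed.

(** Coefficient M + j of g h is g_M h_j plus products that vanish by the order of g or by induction
    on j. This carries the division by P_M. *)
Lemma poly_mul_coef_eq0 (C : idomainType) (g h : {poly C}) (M k : nat) :
  (forall i, (i < M)%N -> g`_i = 0) -> g`_M != 0 ->
  (forall m, (m <= M + k)%N -> (g * h)`_m = 0) ->
  forall j, (j <= k)%N -> h`_j = 0.
Proof.
move=> g0 gM gh0; elim/ltn_ind => j IH jk.
have := gh0 (M + j)%N; rewrite leq_add2l => /(_ jk) /eqP.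
have MS : (M < (M + j).+1)%N by rewrite ltnS leq_addr.
rewrite coefM (bigD1 (Ordinal MS)) //= addKn big1 ?addr0 => [|i iM].
  by rewrite mulf_eq0 (negbTE gM) => /eqP.
have [/g0 ->|Mi] := ltnP i M; first by rewrite mul0r.
have {}Mi : (M < i)%N by rewrite ltn_neqAle Mi andbT eq_sym.
have ij : (M + j - i < j)%N by rewrite ltn_subLR ?ltn_add2r // -ltnS.
by rewrite IH ?mulr0 // (leq_trans (ltnW ij)).
Qed.

(** With T the truncated series, q - p T = p (f - T) on the ray is O(s^M) O(s^N), so no coefficient
    of degree below M + N survives. *)
Lemma radial_expansion_coef (C : numClosedFieldType) (d : nat)
    (q p : {mpoly C[d.+1]}) (M : nat) (z : 'rV[C]_d.+1) (a : nat -> C) :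
  vanishing_order p M -> peval (homog_part M p) z != 0 ->
  radial_expansion (ratfun q p) z a ->
  forall N m, (m < M + N)%N ->
    (line_poly q 0 z)`_m = (line_poly p 0 z * \poly_(j < N) a j)`_m.
Proof.
move=> p_order PMz expz N m mN.
apply/eqP; rewrite -subr_eq0 -coefB; apply/eqP.
apply: poly_littleo_coef (leqnn m) => e e0.
have [B [dl [B0 dl0 HB]]] := power_series_remainder expz N.
have p_lt := line_poly_coef_lt z p_order.
have [D D0 HD] := poly_upper_bound p_lt.
(* z may lie outside H^d; P_M(z) != 0 makes p(s z) != 0 for small s > 0, so that f is there a true
   quotient and not the default 0. *)
have [|dl' [dl'0 dl'1 Hdl']] := poly_lower_bound p_lt.
  by rewrite coef_line_poly0.
have [t [t0 tdl t1 tD]] := small_pos dl0 (mulr_ge0 D0 B0) e0.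
have [x [x0 xdl xt]] := pos_lt2 dl'0 t0.
exists x => // s s0 sx; have ns : `|s| = s by rewrite gtr0_norm.
have ps : peval p (s *: z) != 0.
  rewrite -normr_gt0 -[s *: z]add0r -horner_line_poly.
  have := Hdl' s; rewrite ns => /(_ (lt_trans sx xdl)); apply: lt_le_trans.
  by rewrite mulr_gt0 ?exprn_gt0 // divr_gt0 // coef_line_poly0 normr_gt0.
have -> : (line_poly q 0 z - line_poly p 0 z * \poly_(j < N) a j).[s]
          = (line_poly p 0 z).[s]
            * (ratfun q p (s *: z) - \sum_(0 <= j < N) a j * s ^+ j).
  rewrite hornerD hornerN hornerM !horner_line_poly add0r horner_poly big_mkord.
  by rewrite mulrBr /ratfun mulrCA divff // mulr1.
have st := lt_trans sx xt; have sdl := lt_trans st tdl.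
have s1 : s <= 1 := le_trans (ltW st) t1.
have := HB s; rewrite gt_eqF // ns => /(_ isT sdl) HBs.
have := HD s; rewrite ns => /(_ s1) HDs.
rewrite normrM; apply: (le_trans (ler_pM _ _ HDs HBs)) => //.
rewrite mulrACA -exprD; apply: (@le_trans _ _ (D * B * s ^+ m.+1)).
  by rewrite ler_wpM2l ?mulr_ge0 // ler_wiXn2l // ltW.
rewrite exprS mulrA ler_wpM2r ?exprn_ge0 ?(ltW s0) //.
by apply: le_trans (ltW tD); rewrite ler_wpM2l ?mulr_ge0 // ltW.
Qed.

(** * Explicit forms of non-tangential O and o *)

Lemma nt_bigOP (C : numClosedFieldType) (d m : nat) (u : 'rV[C]_d.+1 -> C) :
  nt_bigO m u <->
  forall c, 1 <= c -> exists B dl, [/\ 0 < B, 0 < dl & forall z, AR c z ->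
    `|z 0 0| < dl -> `|u z| <= B * `|z 0 0| ^+ m].
Proof.
split=> H c c1.
  have /eqO_exP [B B0 /(near_ntP _ c1) [dl dl0 HB]] := H c c1.
  exists B, dl; split=> // z Az zdl.
  by have := HB z Az zdl; rewrite normrX normr_id.
have [B [dl [B0 dl0 HB]]] := H c c1.
apply/eqO_exP; exists B => //; apply/(near_ntP _ c1); exists dl => // z Az zdl.
by rewrite normrX normr_id; exact: HB.
Qed.

Lemma nt_littleoP (C : numClosedFieldType) (d m : nat) (u : 'rV[C]_d.+1 -> C) :
  nt_littleo m u <->
  forall c e, 1 <= c -> 0 < e -> exists2 dl, 0 < dl & forall z, AR c z ->
    `|z 0 0| < dl -> `|u z| <= e * `|z 0 0| ^+ m.
Proof.
split=> [H c e c1 e0|H c c1].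
  have /eqoP /(_ e e0) /(near_ntP _ c1) [dl dl0 He] := H c c1.
  exists dl => // z Az zdl.
  by have := He z Az zdl; rewrite normrX normr_id.
apply/eqoP => e e0; apply/(near_ntP _ c1).
have [dl dl0 He] := H c e c1 e0; exists dl => // z Az zdl.
by rewrite normrX normr_id; exact: He.
Qed.

Lemma nt_bigO_littleo (C : numClosedFieldType) (d m : nat)
    (u : 'rV[C]_d.+1 -> C) : nt_bigO m.+1 u -> nt_littleo m u.
Proof.
move=> /nt_bigOP H; apply/nt_littleoP => c e c1 e0.
have [B [dl [B0 dl0 HB]]] := H c c1.
have [s [s0 sdl _ Bs]] := small_pos dl0 (ltW B0) e0.
exists s => // z Az zs; apply: (le_trans (HB z Az (lt_trans zs sdl))).
rewrite exprS mulrA ler_wpM2r ?exprn_ge0 //; apply: le_trans (ltW Bs).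
by rewrite ler_wpM2l // ltW.
Qed.

Lemma msize_homog_part (C : numClosedFieldType) (d m : nat)
    (g : {mpoly C[d.+1]}) : (msize (homog_part m g) <= m.+1)%N.
Proof.
rewrite mmeasureE; apply/bigmax_leqP_seq => u ug _.
by have /dhomogP /(_ u ug) -> := pihomogP mdeg m g.
Qed.

(** * Growth orders on a fixed approach region *)

Section Growth.
Variables (C : numClosedFieldType) (d : nat) (c : C).
Hypothesis c_ge1 : 1 <= c.

(** The range |z_1| <= 1 is fixed, so that sums and products need no new radius and a higher order
    implies every lower one. *)
Definition AR_bounded (m : nat) (u : 'rV[C]_d.+1 -> C) : Prop :=
  exists2 B, 0 <= B &
    forall z, AR c z -> `|z 0 0| <= 1 -> `|u z| <= B * `|z 0 0| ^+ m.

Lemma AR_bounded_weaken m n u : (m <= n)%N -> AR_bounded n u -> AR_bounded m u.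
Proof.
move=> mn [B B0 HB]; exists B => // z Az z1; apply: (le_trans (HB z Az z1)).
by rewrite ler_wpM2l // ler_wiXn2l.
Qed.

Lemma eq_AR_bounded m u v : (forall z, AR c z -> u z = v z) ->
  AR_bounded m u -> AR_bounded m v.
Proof. by move=> uv [B B0 HB]; exists B => // z Az; rewrite -uv //; exact: HB. Qed.

Lemma AR_boundedB m u v : AR_bounded m u -> AR_bounded m v ->
  AR_bounded m (fun z => u z - v z).
Proof.
move=> [A A0 HA] [B B0 HB]; exists (A + B) => [|z Az z1]; first exact: addr_ge0.
by rewrite mulrDl (le_trans (ler_normB _ _)) // lerD ?HA ?HB.
Qed.

Lemma AR_boundedM m n u v : AR_bounded m u -> AR_bounded n v ->
  AR_bounded (m + n) (fun z => u z * v z).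
Proof.
move=> [A A0 HA] [B B0 HB]; exists (A * B) => [|z Az z1]; first exact: mulr_ge0.
by rewrite exprD mulrACA normrM ler_pM // ?HA ?HB.
Qed.

Lemma AR_bounded_sum m n (u : nat -> 'rV[C]_d.+1 -> C) :
  (forall i, (i < n)%N -> AR_bounded m (u i)) ->
  AR_bounded m (fun z => \sum_(i < n) u i z).
Proof.
elim: n => [|n IH] hu.
  by exists 0 => // z _ _; rewrite big_ord0 normr0 mul0r.
have [A A0 HA] := IH (fun i ni => hu i (ltnW ni)).
have [B B0 HB] := hu n (ltnSn n).
exists (A + B) => [|z Az z1]; first exact: addr_ge0.
by rewrite big_ord_recr /= mulrDl (le_trans (ler_normD _ _)) // lerD ?HA ?HB.
Qed.

(** On AR_c each monomial of degree m has modulus at most (c |z_1|)^m. *)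
Lemma AR_bounded_line_coef (g : {mpoly C[d.+1]}) (m : nat) :
  AR_bounded m (fun z => (line_poly g 0 z)`_m).
Proof.
have c0 : 0 <= c by exact: le_trans c_ge1.
exists (\sum_(u <- msupp g | mdeg u == m) `|g@_u| * c ^+ m) => [|z Az _].
  by rewrite sumr_ge0 // => u _; rewrite mulr_ge0 ?exprn_ge0.
rewrite coef_line_poly0 /peval /homog_part pihomogE raddf_sum /= mulr_suml.
apply: (le_trans (ler_norm_sum _ _ _)); apply: ler_sum => u /eqP <-.
rewrite mevalZ mevalX normrM -mulrA ler_wpM2l // normr_prod -exprMn mdegE.
rewrite -prodrXr; apply: ler_prod => i _; rewrite normr_ge0 normrX /=.
by rewrite lerXn2r ?nnegrE ?mulr_ge0 //; exact: AR_norm_le.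
Qed.

End Growth.

(** * The radial coefficients, the remainder and the two implications *)

Section RadialTaylor.
Variables (C : numClosedFieldType) (d : nat) (q p : {mpoly C[d.+1]}) (M : nat).
Variable F : nat -> 'rV[C]_d.+1 -> C.
Hypothesis p_neq0 : forall z, uhp z -> peval p z != 0.
Hypothesis p_order : vanishing_order p M.
Hypothesis f_expansion : forall z, peval (homog_part M p) z != 0 ->
  radial_expansion (ratfun q p) z (fun j => F j z).

Lemma AR_homog_part_neq0 c z : 1 <= c -> AR c z -> peval (homog_part M p) z != 0.
Proof.
move=> /(homog_part_lower_bound p_neq0 p_order) [K K0 HK] Az.
rewrite -normr_gt0; apply: lt_le_trans (HK z Az).
by rewrite mulr_gt0 // exprn_gt0 // (AR_norm0_gt0 Az).
Qed.

(** The term with P_M is isolated in the convolution for Q_(M+j); the truncation [N := j.+1] is just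
    long enough to reach that coefficient. *)
Lemma radial_coef_rec z j : peval (homog_part M p) z != 0 ->
  peval (homog_part M p) z * F j z
  = (line_poly q 0 z)`_(M + j)
    - \sum_(i < j) (line_poly p 0 z)`_(M + i.+1) * F (j - i.+1)%N z.
Proof.
move=> PMz.
rewrite (radial_expansion_coef p_order PMz (f_expansion PMz) (N := j.+1)) ?ltn_add2l //.
rewrite coefM -addnS big_split_ord /= big1 ?add0r => [|i _]; last first.
  by rewrite (line_poly_coef_lt z p_order) ?mul0r.
rewrite big_ord_recl /= addn0 addKn coef_poly ltnSn coef_line_poly0.
rewrite (eq_bigr (fun i : 'I_j => (line_poly p 0 z)`_(M + i.+1) * F (j - i.+1)%N z)).
  by rewrite addrK.
move=> i _; rewrite /bump /= add1n subnDl coef_poly ifT //.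
by rewrite ltnS leq_subr.
Qed.

(** By induction every term of the recursion has order M + j; the lower bound for P_M then removes
    exactly r^M. *)
Lemma AR_bounded_radial_coef c j : 1 <= c -> AR_bounded c j (F j).
Proof.
move=> c1; have [K K0 HK] := homog_part_lower_bound p_neq0 p_order c1.
elim/ltn_ind: j => j IH.
have : AR_bounded c (M + j) (fun z => peval (homog_part M p) z * F j z).
  apply: (@eq_AR_bounded _ _ _ _ (fun z => (line_poly q 0 z)`_(M + j)
    - \sum_(i < j) (line_poly p 0 z)`_(M + i.+1) * F (j - i.+1)%N z)).
    by move=> z Az; rewrite radial_coef_rec // (AR_homog_part_neq0 c1 Az).
  apply: AR_boundedB; first exact: AR_bounded_line_coef.
  apply: (@AR_bounded_sum _ _ _ _ _
    (fun i z => (line_poly p 0 z)`_(M + i.+1) * F (j - i.+1)%N z)) => i ij.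
  have -> : (M + j = (M + i.+1) + (j - i.+1))%N by rewrite -addnA subnKC.
  apply: AR_boundedM; first exact: AR_bounded_line_coef.
  by apply: IH; rewrite ltn_subrL (leq_ltn_trans _ ij).
move=> [B B0 HB]; exists (B / K) => [|z Az z1].
  by rewrite divr_ge0 // ltW.
have r0 := AR_norm0_gt0 Az.
have := HB z Az z1; rewrite normrM exprD mulrA => h.
rewrite mulrAC ler_pdivlMr //.
rewrite -(ler_pM2r (exprn_gt0 M r0)) -mulrA [leLHS]mulrC.
by rewrite [leRHS]mulrAC; apply: le_trans h; rewrite ler_wpM2r // HK.
Qed.

(** q - p F is the value at t = 1 of a polynomial in t whose coefficients below degree M + k + 1
    vanish and whose coefficient of degree m is O(r^m). *)
Lemma radial_remainder_bounded c k : 1 <= c ->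
  AR_bounded c (M + k.+1)
    (fun z => peval q z - peval p z * \sum_(0 <= j < k.+1) F j z).
Proof.
move=> c1; pose h z := line_poly q 0 z - line_poly p 0 z * \poly_(j < k.+1) F j z.
(* A length valid for all z, so that finitely many estimates with uniform constants suffice. *)
pose N := maxn (msize q) (msize p + k.+1).
apply: (@eq_AR_bounded _ _ _ _ (fun z => \sum_(m < N)
   if (m < M + k.+1)%N then 0 else (h z)`_m)).
  move=> z Az; have PMz := AR_homog_part_neq0 c1 Az.
  have -> : peval q z - peval p z * \sum_(0 <= j < k.+1) F j z = (h z).[1].
    rewrite /h hornerD hornerN hornerM !horner_line_poly add0r scale1r.
    rewrite horner_poly big_mkord; congr (_ - _ * _).
    by apply: eq_bigr => i _; rewrite expr1n mulr1.
  rewrite (@horner_coef_wide _ N); last first.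
    rewrite (leq_trans (size_polyD _ _)) // size_polyN geq_max !leq_max.
    rewrite size_line_poly /= orbC (leq_trans (size_polyMleq _ _)) //.
    rewrite (leq_trans (leq_pred _)) // leq_add ?size_line_poly ?size_poly //.
  apply: eq_bigr => m _; rewrite expr1n mulr1; case: ifP => // mMk.
  rewrite /h coefB (radial_expansion_coef p_order PMz (f_expansion PMz) mMk).
  by rewrite subrr.
apply: (@AR_bounded_sum _ _ _ _ _
  (fun m z => if (m < M + k.+1)%N then 0 else (h z)`_m)) => m _.
case: ltnP => [_|Mkm]; first by exists 0 => // z _ _; rewrite normr0 mul0r.
apply: AR_bounded_weaken Mkm _; apply: (@eq_AR_bounded _ _ _ _
  (fun z => (line_poly q 0 z)`_m - \sum_(i < m.+1) (line_poly p 0 z)`_i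
     * (if (m - i < k.+1)%N then F (m - i)%N z else 0))).
  move=> z _; rewrite /h coefB coefM; congr (_ - _); apply: eq_bigr => i _.
  by rewrite coef_poly.
apply: AR_boundedB; first exact: AR_bounded_line_coef.
apply: (@AR_bounded_sum _ _ _ _ _ (fun i z => (line_poly p 0 z)`_i
     * (if (m - i < k.+1)%N then F (m - i)%N z else 0))) => i im.
apply: (@AR_bounded_weaken _ _ _ _ (i + (m - i))); first by rewrite subnKC.
apply: AR_boundedM; first exact: AR_bounded_line_coef.
case: (m - i < k.+1)%N; first exact: AR_bounded_radial_coef.
by exists 0 => // z _ _; rewrite normr0 mul0r.
Qed.

Lemma ratfun_radial_remainder k :
  nt_bigO k.+1 (fun z => ratfun q p z - \sum_(0 <= j < k.+1) F j z).
Proof.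
apply/nt_bigOP => c c1.
have [K [dl [K0 dl0 HK]]] := denominator_lower_bound p_neq0 p_order c1.
have [B B0 HB] := radial_remainder_bounded k c1.
have [s [s0 sdl s1]] := pos_lt2 dl0 ltr01.
(* [B] may be 0; [B + 1] keeps the constant positive, as the O-statement demands. *)
exists ((B + 1) / K), s; split=> //; first by rewrite divr_gt0 // ltr_wpDl.
move=> z Az zs; have r0 := AR_norm0_gt0 Az.
have pz : peval p z != 0 by apply: p_neq0; case: Az.
have := HB z Az (ltW (lt_trans zs s1)); have := HK z Az (lt_trans zs sdl).
set r := `|z 0 0| in r0 *; move=> HKz HBz.
have qE : peval q z = peval p z * ratfun q p z.
  by rewrite /ratfun mulrCA divff // mulr1.
rewrite qE -mulrBr in HBz.
rewrite mulrAC ler_pdivlMr // -(ler_pM2r (exprn_gt0 M r0)).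
rewrite -mulrA [leLHS]mulrC; apply: (@le_trans _ _ (B * r ^+ (M + k.+1))).
  by apply: le_trans HBz; rewrite normrM ler_wpM2r.
by rewrite -[leRHS]mulrA -exprD addnC ler_wpM2r ?exprn_ge0 ?(ltW r0) // lerDl.
Qed.

Lemma polynomial_off_nt_Ck k :
  polynomial_off (homog_part M p) (fun z => \sum_(0 <= j < k.+1) F j z) ->
  nt_Ck k (ratfun q p).
Proof.
(* A priori G may have degree above k, so it is truncated; the discarded parts are O(r^(k+1)). *)
move=> [G FG]; exists (\sum_(m < k.+1) homog_part m G); split.
  apply: (leq_trans (msize_sum _ _ _)); apply/bigmax_leqP => m _.
  by apply: leq_trans (msize_homog_part _ _) _; rewrite ltnS -ltnS.
apply: nt_bigO_littleo; apply/nt_bigOP => c c1.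
have /nt_bigOP /(_ c c1) [A [dl [A0 dl0 HA]]] := ratfun_radial_remainder k.
have [B B0 HB] : AR_bounded c k.+1
    (fun z => peval G z - peval (\sum_(m < k.+1) homog_part m G) z).
  apply: (@eq_AR_bounded _ _ _ _
    (fun z => \sum_(i < msize G) (line_poly G 0 z)`_(k.+1 + i))) => [z _|].
    have -> : peval G z = (line_poly G 0 z).[1].
      by rewrite horner_line_poly add0r scale1r.
    rewrite (@horner_coef_wide _ (k.+1 + msize G)); last first.
      by rewrite (leq_trans (size_line_poly _ _ _)) // leq_addl.
    have -> : peval (\sum_(m < k.+1) homog_part m G) z
              = \sum_(m < k.+1) (line_poly G 0 z)`_m * 1 ^+ m.
      rewrite /peval raddf_sum /=; apply: eq_bigr => m _.
      by rewrite expr1n mulr1 coef_line_poly0.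
    rewrite big_split_ord /= [RHS]addrAC subrr add0r.
    by apply: eq_bigr => i _; rewrite expr1n mulr1.
  apply: (@AR_bounded_sum _ _ _ _ _
    (fun i z => (line_poly G 0 z)`_(k.+1 + i))) => i _.
  apply: AR_bounded_weaken (leq_addr i k.+1) _.
  exact: AR_bounded_line_coef.
have [s [s0 sdl s1]] := pos_lt2 dl0 ltr01.
exists (A + B), s; split=> //; first exact: ltr_wpDr.
move=> z Az zs.
have := HA z Az (lt_trans zs sdl); rewrite FG ?(AR_homog_part_neq0 c1 Az) //.
have := HB z Az (ltW (lt_trans zs s1)) => HBz HAz.
rewrite mulrDl; apply: le_trans (lerD HAz HBz).
by apply: le_trans (ler_normD _ _); rewrite addrA subrK.
Qed.

Lemma nt_Ck_polynomial_off k : nt_Ck k (ratfun q p) ->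
  polynomial_off (homog_part M p) (fun z => \sum_(0 <= j < k.+1) F j z).
Proof.
move=> [G [sG /nt_littleoP fG]]; exists G => z PMz.
have line_h y : line_poly (q - p * G) 0 y
                = line_poly q 0 y - line_poly p 0 y * line_poly G 0 y.
  by rewrite /line_poly rmorphB rmorphM.
(* Each ray in H^d stays in one AR_c, so q - p G = p (f - G) is o(t^(M+k)) along it; parts
   annihilated on H^d vanish everywhere. *)
have h0 m y : (m <= M + k)%N -> peval (homog_part m (q - p * G)) y = 0.
  move=> mk; apply: peval_eq0_uhp y => y uy; rewrite -coef_line_poly0.
  move: mk; apply: poly_littleo_coef => e e0.
  have [c c1 Ay] := uhp_AR uy; have r0 := AR_norm0_gt0 Ay.
  set r := `|y 0 0| in r0.
  have [D D0 HD] := poly_upper_bound (line_poly_coef_lt y p_order).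
  have D1 : 0 < D + 1 by exact: ltr_wpDl.
  (* This tolerance absorbs the constant [D] of p on the ray and the factor r^k of |t y_1|^k;
     [D + 1] avoids dividing by 0. *)
  have e'0 : 0 < e / (D + 1) / r ^+ k by rewrite !divr_gt0 // exprn_gt0.
  have [dl dl0 Hdl] := fG c _ c1 e'0.
  have [s [s0 sdl s1]] := pos_lt2 (divr_gt0 dl0 r0) ltr01.
  exists s => // t t0 ts; have nt : `|t| = t by rewrite gtr0_norm.
  have := HD t; rewrite nt => /(_ (ltW (lt_trans ts s1))) HDt.
  have := Hdl _ (AR_scale t0 Ay); rewrite mxE normrM nt -ltr_pdivlMr //.
  move=> /(_ (lt_trans ts sdl)); rewrite -/r exprMn => Ht.
  have pt : peval p (t *: y) != 0 by apply: p_neq0; case: (AR_scale t0 Ay).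
  have -> : (line_poly (q - p * G) 0 y).[t]
    = (line_poly p 0 y).[t] * (ratfun q p (t *: y) - peval G (t *: y)).
    rewrite line_h hornerD hornerN hornerM !horner_line_poly add0r.
    by rewrite mulrBr /ratfun mulrCA divff // mulr1.
  rewrite normrM; apply: (le_trans (ler_pM _ _ HDt Ht)) => //.
  have -> : D * t ^+ M * (e / (D + 1) / r ^+ k * (t ^+ k * r ^+ k))
            = D / (D + 1) * (e * t ^+ (M + k)).
    by rewrite exprD; field; rewrite !gt_eqF ?exprn_gt0.
  rewrite -[leRHS]mul1r ler_wpM2r ?mulr_ge0 ?exprn_ge0 ?(ltW e0) ?(ltW t0) //.
  by rewrite ler_pdivrMr // mul1r lerDl.
(* Multiplied by p, the truncated series and G agree along the ray up to degree M + k; dividing out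
   P_M(z) leaves equal coefficients up to k. *)
have FG j : (j <= k)%N -> F j z = (line_poly G 0 z)`_j.
  move=> jk; apply/eqP; rewrite -subr_eq0.
  suff : (\poly_(i < k.+1) F i z - line_poly G 0 z)`_j = 0.
    by rewrite coefB coef_poly ltnS jk => ->.
  apply: (poly_mul_coef_eq0 (line_poly_coef_lt z p_order) _ _ jk).
    by rewrite coef_line_poly0.
  move=> m mMk; rewrite mulrBr coefB.
  rewrite -(radial_expansion_coef p_order PMz (f_expansion PMz)) ?addnS //.
  by rewrite -coefB -line_h coef_line_poly0 h0.
(* As G has degree at most k, its coefficients up to k on the ray sum to the value at t = 1, namely
   G(z). *)
rewrite big_mkord (eq_bigr (fun i : 'I_k.+1 => (line_poly G 0 z)`_i * 1 ^+ i)).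
  rewrite -horner_coef_wide ?(leq_trans (size_line_poly _ _ _)) //.
  by rewrite horner_line_poly add0r scale1r.
by move=> i _; rewrite expr1n mulr1 FG // -ltnS.
Qed.

End RadialTaylor.

Theorem theorem3p9 (R : realType) (d : nat) (q p : {mpoly R[i][d.+1]})
    (M : nat) (F : nat -> 'rV[R[i]]_d.+1 -> R[i]) (k : nat)
    (p_neq0 : forall z, uhp z -> peval p z != 0)
    (f_lim : has_nt_limit (ratfun q p))
    (p_order : vanishing_order p M)
    (f_expansion : forall z, peval (homog_part M p) z != 0 ->
       radial_expansion (ratfun q p) z (fun j => F j z)) :
  (nt_Ck k (ratfun q p) <->
     polynomial_off (homog_part M p) (fun z => \sum_(0 <= j < k.+1) F j z)) /\
  (polynomial_off (homog_part M p) (fun z => \sum_(0 <= j < k.+1) F j z) ->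
     nt_bigO k.+1 (fun z => ratfun q p z - \sum_(0 <= j < k.+1) F j z)).
Proof.
split; last by move=> _; exact: (ratfun_radial_remainder p_neq0 p_order f_expansion).
split; first exact: (nt_Ck_polynomial_off p_neq0 p_order f_expansion).
exact: (polynomial_off_nt_Ck p_neq0 p_order f_expansion).
Qed.
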